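(* Let $G(z,x)=(1-2xz+z^2)^{-1/2}=\sum_{n\ge0}P_n(x)\,z^n$ denote the Legendre generating function, let $L=(1-x^2)\partial_x^2-2x\,\partial_x$, and let $\mathcal{E}:=z^2\partial_z^2+2z\,\partial_z=z\partial_z(z\partial_z+1)$. Then for every integer $r\ge1$, $$L^r_{(x)}\,G(z,x)=(-1)^r\,\mathcal{E}^r_{(z)}\,G(z,x).$$
   Context: $P_n(x)$ are the Legendre polynomials normalised by $P_n(1)=1$. The subscripts $(x)$ and $(z)$ indicate that $L$ acts in the variable $x$ and $\mathcal{E}$ in the variable $z$. $G$ is regarded as a power series in $z$ with coefficients in $\mathbb{C}[x]$. *)

(* Defs.v *)
From HB Require Import structures.
From mathcomp Require Import all_boot all_order all_algebra.
From mathcomp Require Import boolp reals complex.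

Set Implicit Arguments.
Unset Strict Implicit.
Unset Printing Implicit Defensive.

Import GRing.Theory.
Local Open Scope ring_scope.

(** * Formal power series in one variable z over a commutative ring *)

(* A record rather than a copy of [nat -> A], so that the Cauchy product below
   cannot be confused with the pointwise product of functions. *)
Record fps (A : comNzRingType) := Fps { fcoef : nat -> A }.

Section FpsRing.
Variable A : comNzRingType.
Implicit Types F G H : fps A.

Lemma fpsP F G : fcoef F =1 fcoef G <-> F = G.
Proof.
split=> [|-> //]; case: F => f; case: G => g /= fg.
by congr Fps; apply/funext.
Qed.

HB.instance Definition _ := gen_eqMixin (fps A).
HB.instance Definition _ := gen_choiceMixin (fps A).

Definition fps0 : fps A := Fps (fun=> 0).
Definition fps_opp F := Fps (fun n => - fcoef F n).
Definition fps_add F G := Fps (fun n => fcoef F n + fcoef G n).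

Fact fps_addA : associative fps_add.
Proof. by move=> F G H; apply/fpsP => n /=; rewrite addrA. Qed.
Fact fps_addC : commutative fps_add.
Proof. by move=> F G; apply/fpsP => n /=; rewrite addrC. Qed.
Fact fps_add0 : left_id fps0 fps_add.
Proof. by move=> F; apply/fpsP => n /=; rewrite add0r. Qed.
Fact fps_addN : left_inverse fps0 fps_opp fps_add.
Proof. by move=> F; apply/fpsP => n /=; rewrite addNr. Qed.

HB.instance Definition _ :=
  GRing.isZmodule.Build (fps A) fps_addA fps_addC fps_add0 fps_addN.

Definition fps_const (a : A) : fps A := Fps (fun n => if n == 0%N then a else 0).
Definition fps_mul F G :=
  Fps (fun n => \sum_(k < n.+1) fcoef F k * fcoef G (n - k)%N).

Definition fps_trunc N F : {poly A} := \poly_(i < N) fcoef F i.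

Fact coef_fps_trunc N F n : (n < N)%N -> (fps_trunc N F)`_n = fcoef F n.
Proof. by move=> ltnN; rewrite coef_poly ltnN. Qed.

Fact fps_mul_trunc N F G n : (n < N)%N ->
  fcoef (fps_mul F G) n = (fps_trunc N F * fps_trunc N G)`_n.
Proof.
move=> ltnN; rewrite coefM; apply: eq_bigr => i _.
rewrite !coef_fps_trunc //; first by apply: leq_ltn_trans ltnN; rewrite leq_subr.
by apply: leq_ltn_trans ltnN; rewrite -ltnS.
Qed.

Fact fps_mulC : commutative fps_mul.
Proof.
by move=> F G; apply/fpsP => n; rewrite !(@fps_mul_trunc n.+1) // mulrC.
Qed.

Fact fps_mulA : associative fps_mul.
Proof.
move=> F G H; apply/fpsP => n.
transitivity (fps_trunc n.+1 F * fps_trunc n.+1 G * fps_trunc n.+1 H)`_n.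
  rewrite -mulrA coefM; apply: eq_bigr => i _.
  rewrite coef_fps_trunc // (@fps_mul_trunc n.+1) // ltnS leq_subr //.
rewrite coefM; apply: eq_bigr => i _.
by rewrite coef_fps_trunc ?ltnS ?leq_subr // (@fps_mul_trunc n.+1).
Qed.

Fact fps_mul1 : left_id (fps_const 1) fps_mul.
Proof.
move=> F; apply/fpsP => n /=.
rewrite big_ord_recl /= mul1r subn0 big1 ?addr0 // => i _.
by rewrite mul0r.
Qed.

Fact fps_mulDl : left_distributive fps_mul fps_add.
Proof.
move=> F G H; apply/fpsP => n /=.
by rewrite -big_split; apply: eq_bigr => i _; rewrite mulrDl.
Qed.

Fact fps_1_neq0 : fps_const 1 != 0.
Proof.
by apply/eqP => /fpsP/(_ 0%N) /= /eqP; rewrite oner_eq0.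
Qed.

HB.instance Definition _ :=
  GRing.Zmodule_isComNzRing.Build (fps A)
    fps_mulA fps_mulC fps_mul1 fps_mulDl fps_1_neq0.

Definition fps_z : fps A := Fps (fun n => (n == 1%N)%:R).

Definition fps_Dz F : fps A := Fps (fun n => fcoef F n.+1 *+ n.+1).

End FpsRing.

Arguments fps_z {A}.

(** * Powers with an arbitrary exponent *)

Definition gbinom (K : fieldType) (a : K) (k : nat) : K :=
  (\prod_(i < k) (a - i%:R)) / k`!%:R.

(* F ^ a = \sum_k gbinom a k (F - 1)^k, meant for F with constant term 1 and
   K of characteristic 0: then (F - 1)^k has no term of degree < k in z, so
   the coefficient of z^n only involves the indices k <= n. *)
Definition fps_powr (K : fieldType) (A : comAlgType K) (F : fps A) (a : K) :
  fps A :=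
  Fps (fun n => \sum_(k < n.+1) gbinom a k *: fcoef ((F - 1) ^+ k) n).

(** * Power series in z with coefficients in K[x] *)

Section Legendre.
Variable K : fieldType.

Definition fps_x : fps {poly K} := fps_const 'X.

Definition fps_Dx (F : fps {poly K}) : fps {poly K} :=
  Fps (fun n => (fcoef F n)^`()).

Definition legendre_op (F : fps {poly K}) : fps {poly K} :=
  (1 - fps_x ^+ 2) * fps_Dx (fps_Dx F) - 2 * fps_x * fps_Dx F.

Definition euler_op (F : fps {poly K}) : fps {poly K} :=
  fps_z ^+ 2 * fps_Dz (fps_Dz F) + 2 * fps_z * fps_Dz F.

Definition legendre_gen : fps {poly K} :=
  fps_powr (1 - 2 * fps_x * fps_z + fps_z ^+ 2) (- 2^-1).

(* Rodrigues' formula (K of characteristic 0). *)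
Definition legendre (n : nat) : {poly K} :=
  (2 ^+ n * n`!%:R)^-1 *: (('X^2 - 1) ^+ n)^`(n).

Lemma derivn_XsubC1_exp (n : nat) (q : {poly K}) :
  ((('X - 1) ^+ n * q)^`(n)).[1] = n`!%:R * q.[1].
Proof.
elim: n q => [|n IHn] q; first by rewrite expr0 !mul1r.
have -> : ((('X - 1) ^+ n.+1 * q)^`(n.+1)) =
    (('X - 1) ^+ n * (n.+1%:R *: q + ('X - 1) * q^`()))^`(n).
  rewrite derivSn derivM deriv_exp derivB derivX -[1]/(1%:P) derivC subr0 mul1r.
  by rewrite mulrDr mulrA -exprSr scaler_nat mulrnAl mulrnAr.
rewrite IHn !hornerE subrr mul0r addr0 factS natrM.
by rewrite mulrCA mulrA.
Qed.

Lemma legendre_at1 (n : nat) : [pchar K] =i pred0 -> (legendre n).[1] = 1.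
Proof.
move=> char0; have nz m : (0 < m)%N -> m%:R != 0 :> K.
  by move=> m_gt0; rewrite pcharf0P // in char0 *; rewrite char0 -lt0n.
rewrite /legendre hornerZ -[X in 'X^2 - X](expr1n _ 2) subr_sqr exprMn.
rewrite derivn_XsubC1_exp horner_exp hornerD hornerX hornerC [X in _ * X]mulrC.
by rewrite mulVf // mulf_neq0 ?expf_neq0 ?nz // fact_gt0.
Qed.

End Legendre.

(* Main.v *)
(* Two first-order relations for Rodrigues' polynomials,
     (n+1) P_(n+1) = (x^2-1) P_n' + (n+1) x P_n   and
     P_(n+1)' = x P_n' + (n+1) P_n,
   imply both the Legendre equation L P_n = - n(n+1) P_n and Bonnet's three-term
   recurrence.  The latter is also satisfied by the coefficients of
   G = F^(-1/2), F = 1-2xz+z^2, because F dG/dz = -1/2 (dF/dz) G.  Hence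
   G = \sum_n P_n z^n, and since E z^n = n(n+1) z^n, both L^r and (-1)^r E^r
   multiply the n-th term by (-n(n+1))^r. *)

Require Import Defs.
From mathcomp Require Import all_boot all_order all_algebra.
From mathcomp Require Import boolp reals complex.
From mathcomp Require Import ring.
Set Implicit Arguments.
Unset Strict Implicit.
Unset Printing Implicit Defensive.
Import GRing.Theory.
Local Open Scope ring_scope.

(** * Coefficient calculus for formal power series *)

Section Fps.
Variable A : comNzRingType.
Implicit Types F G : fps A.

Lemma fcoefD F G n : fcoef (F + G) n = fcoef F n + fcoef G n.
Proof. by []. Qed.

Lemma fcoefN F n : fcoef (- F) n = - fcoef F n.
Proof. by []. Qed.

Lemma fcoef1 n : fcoef (1 : fps A) n = (n == 0)%:R.
Proof. by rewrite /=; case: eqP. Qed.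

Lemma fcoef_sum n N (E : 'I_N -> fps A) :
  fcoef (\sum_i E i) n = \sum_i fcoef (E i) n.
Proof. exact: (big_morph (fun F => fcoef F n)). Qed.

Lemma fcoefM F G n : fcoef (F * G) n = \sum_(k < n.+1) fcoef F k * fcoef G (n - k).
Proof. by []. Qed.

Lemma fcoef_constM a F n : fcoef (fps_const a * F) n = a * fcoef F n.
Proof.
rewrite fcoefM big_ord_recl /= subn0 big1 ?addr0 // => i _.
by rewrite mul0r.
Qed.

Lemma fcoef_natM m F n : fcoef (m%:R * F) n = m%:R * fcoef F n.
Proof.
rewrite !mulr_natl; elim: m => [|m IHm]; first by rewrite !mulr0n.
by rewrite !mulrS fcoefD IHm.
Qed.

Lemma fcoef_zM0 F : fcoef (fps_z * F) 0 = 0.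
Proof. by rewrite fcoefM big_ord1 mul0r. Qed.

Lemma fcoef_zMS F n : fcoef (fps_z * F) n.+1 = fcoef F n.
Proof.
rewrite fcoefM !big_ord_recl /= mul0r add0r mul1r subSS subn0 big1 ?addr0 //.
by move=> i _; rewrite mul0r.
Qed.

Lemma fps_constD a b : fps_const (a + b) = fps_const a + fps_const b :> fps A.
Proof. by apply/fpsP => -[|n] //=; rewrite addr0. Qed.

Lemma fps_constM a b : fps_const (a * b) = fps_const a * fps_const b :> fps A.
Proof. by apply/fpsP => -[|n]; rewrite fcoef_constM //= mulr0. Qed.

Lemma fcoef_Dz F n : fcoef (fps_Dz F) n = n.+1%:R * fcoef F n.+1.
Proof. by rewrite mulr_natl. Qed.

Lemma fps_DzD F G : fps_Dz (F + G) = fps_Dz F + fps_Dz G.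
Proof. by apply/fpsP => n; rewrite fcoefD !fcoef_Dz fcoefD mulrDr. Qed.

Lemma fps_DzM F G : fps_Dz (F * G) = fps_Dz F * G + F * fps_Dz G.
Proof.
apply/fpsP => n; rewrite fcoefD fcoef_Dz !fcoefM.
rewrite mulr_sumr.
(* Leibniz's rule on coefficients: the weight [n.+1] splits as [k + (n.+1 - k)], one share for each
   factor. *)
have -> : \sum_(k < n.+2) n.+1%:R * (fcoef F k * fcoef G (n.+1 - k)) =
    \sum_(k < n.+2) k%:R * (fcoef F k * fcoef G (n.+1 - k)) +
    \sum_(k < n.+2) (n.+1 - k)%:R * (fcoef F k * fcoef G (n.+1 - k)).
  rewrite -big_split; apply: eq_bigr => k _ /=.
  by rewrite -mulrDl -natrD subnKC // -ltnS.
congr (_ + _).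
  rewrite big_ord_recl mul0r add0r; apply: eq_bigr => k _.
  by rewrite fcoef_Dz mulrA.
rewrite big_ord_recr /= subnn mul0r addr0; apply: eq_bigr => k _.
by rewrite -[in RHS]mulr_natl subSn -1?ltnS // mulrCA.
Qed.

Lemma fps_Dz_const a : fps_Dz (fps_const a) = 0 :> fps A.
Proof. by apply/fpsP => n; rewrite fcoef_Dz mulr0. Qed.

Lemma fps_Dz_exp F n : fps_Dz (F ^+ n.+1) = n.+1%:R * F ^+ n * fps_Dz F.
Proof.
elim: n => [|n IHn]; first by rewrite expr1 expr0 !mul1r.
rewrite exprS fps_DzM IHn (exprS F n) -(natr1 n.+1); ring.
Qed.

(** A series without constant term is divisible by [z], so its [k]-th power is divisible by
    [z^k]. *)
Lemma fcoef_exp_low F k n : fcoef F 0 = 0 -> (n < k)%N -> fcoef (F ^+ k) n = 0.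
Proof.
move=> F0; elim: k n => // k IHk n; rewrite ltnS => le_nk.
rewrite exprS fcoefM big_ord_recl F0 mul0r add0r big1 // => i _.
rewrite IHk ?mulr0 //= /bump leq0n add1n.
by case: n i le_nk => [[]//|n] i lt_nk; rewrite subSS (leq_ltn_trans _ lt_nk) ?leq_subr.
Qed.

Lemma fcoefM_low F G n :
  (forall k, (k <= n)%N -> fcoef G k = 0) -> fcoef (F * G) n = 0.
Proof.
by move=> G0; rewrite fcoefM big1 // => k _; rewrite G0 ?mulr0 ?leq_subr.
Qed.

(** Lets a series be replaced by a truncation under a product. *)
Lemma eq_fcoefM F G H n : (forall k, (k <= n)%N -> fcoef G k = fcoef H k) ->
  fcoef (F * G) n = fcoef (F * H) n.
Proof.
by move=> GH; rewrite !fcoefM; apply: eq_bigr => k _; rewrite GH ?leq_subr.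
Qed.

End Fps.

(** * The Euler operator on coefficients *)

Lemma fcoef_euler_op (K : fieldType) (F : fps {poly K}) n :
  fcoef (euler_op F) n = (n * n.+1)%:R * fcoef F n.
Proof.
rewrite /euler_op fcoefD expr2 -!mulrA fcoef_natM.
case: n => [|n]; first by rewrite !fcoef_zM0 mulr0 addr0 mul0r.
rewrite !fcoef_zMS fcoef_Dz.
case: n => [|n]; first by rewrite fcoef_zM0 add0r; ring.
rewrite fcoef_zMS !fcoef_Dz; ring.
Qed.

Lemma euler_opE (K : fieldType) (F : fps {poly K}) :
  euler_op F = fps_z * fps_Dz (fps_z * fps_Dz F + F).
Proof.
apply/fpsP => n; rewrite fcoef_euler_op.
case: n => [|n]; first by rewrite fcoef_zM0 mul0r.
rewrite fcoef_zMS fcoef_Dz fcoefD fcoef_zMS fcoef_Dz; ring.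
Qed.

(** * The differential equation of the binomial series *)

Section BinomialSeries.
Variables (K : fieldType) (A : comAlgType K).
Hypothesis charK0 : [pchar K] =i pred0.
Implicit Types (F : fps A) (a : K).

Let natK_neq0 n : n.+1%:R != 0 :> K.
Proof. by rewrite ((pcharf0P K).1 charK0). Qed.

Lemma gbinom0 a : gbinom a 0 = 1.
Proof. by rewrite /gbinom big_ord0 fact0 divr1. Qed.

Lemma gbinomS a k : k.+1%:R * gbinom a k.+1 = (a - k%:R) * gbinom a k.
Proof.
have fact_neq0 : k`!%:R != 0 :> K by rewrite -(prednK (fact_gt0 k)) natK_neq0.
rewrite /gbinom big_ord_recr /= factS natrM.
by field; rewrite fact_neq0 addrC natr1 natK_neq0.
Qed.

(* Polynomial truncation of the binomial series: unlike fps_powr it can be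
   differentiated termwise, and it agrees with fps_powr below degree N. *)
Let psum N F a : fps A :=
  \sum_(k < N) fps_const (gbinom a k)%:A * (F - 1) ^+ k.

Lemma fcoef_powr N F a n : fcoef F 0 = 1 -> (n < N)%N ->
  fcoef (fps_powr F a) n = fcoef (psum N F a) n.
Proof.
move=> F1 lt_nN; rewrite fcoef_sum.
transitivity (\sum_(k < n.+1) gbinom a k *: fcoef ((F - 1) ^+ k) n) => //.
have F0 : fcoef (F - 1) 0 = 0 by rewrite fcoefD F1 fcoefN fcoef1 subrr.
rewrite (big_ord_widen _ (fun k => gbinom a k *: fcoef ((F - 1) ^+ k) n) lt_nN).
rewrite big_mkcond; apply: eq_bigr => k _.
rewrite fcoef_constM mulr_algl; case: ltnP => // lt_nk.
by rewrite fcoef_exp_low ?scaler0.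
Qed.

(** The equation [F * G' = a * F' * G] holds for the truncation up to a defect carrying
    [(F - 1) ^+ N]. In the induction, writing [F = 1 + (F - 1)] in the derivative of the new term
    cancels the old defect, and [gbinomS] identifies the new one. *)
Lemma fps_Dz_psum N F a : F * fps_Dz (psum N.+1 F a) =
  fps_const a%:A * (fps_Dz F * psum N.+1 F a) -
  fps_const (N.+1%:R * gbinom a N.+1)%:A * (F - 1) ^+ N * fps_Dz F.
Proof.
have DF1 : fps_Dz (F - 1) = fps_Dz F.
  rewrite -[in RHS](subrK 1 F) [RHS]fps_DzD.
  by rewrite (_ : fps_Dz (1 : fps A) = 0) ?addr0 //; exact: fps_Dz_const.
elim: N => [|N IHN].
  rewrite /psum big_ord1 gbinomS /= gbinom0 subr0 mulr1 expr0 scale1r !mulr1.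
  by rewrite fps_Dz_const mulr0 subrr.
rewrite /psum big_ord_recr -/(psum N.+1 F a) /= fps_DzD mulrDr IHN.
rewrite fps_DzM fps_Dz_const mul0r add0r fps_Dz_exp DF1 (gbinomS a N.+1).
set c := gbinom a N.+1.
have -> : ((a - N.+1%:R) * c)%:A = a%:A * c%:A - N.+1%:R * c%:A :> A.
  by rewrite mulrBl scalerBl !mulr_natl -scalerMnl mulr_algl scalerA.
have -> : (N.+1%:R * c)%:A = N.+1%:R * c%:A :> A.
  by rewrite !mulr_natl scalerMnl.
(* [fps_const] is opaque to [ring], so it is first pushed through the ring operations. *)
have cN b : fps_const (- b) = - fps_const b :> fps A.
  by apply/fpsP => -[|n] //=; rewrite oppr0.
have cn n : fps_const n%:R = n%:R :> fps A.
  elim: n => [|n IHn]; last by rewrite -!natr1 fps_constD IHn.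
  by apply/fpsP => -[|n].
rewrite fps_constD cN !fps_constM cn (exprS (F - 1) N); ring.
Qed.

Lemma fps_Dz_powr F a : fcoef F 0 = 1 ->
  F * fps_Dz (fps_powr F a) = fps_const a%:A * (fps_Dz F * fps_powr F a).
Proof.
move=> F1; apply/fpsP => n.
have F0 : fcoef (F - 1) 0 = 0 by rewrite fcoefD F1 fcoefN fcoef1 subrr.
(* [fps_Dz] reads one coefficient further, up to degree [n.+1], hence a truncation at [n.+2]; its
   defect contains [(F - 1) ^+ n.+1] and does not reach degree [n]. *)
rewrite (@eq_fcoefM _ F _ (fps_Dz (psum n.+2 F a))); last first.
  by move=> k le_kn; rewrite !fcoef_Dz (@fcoef_powr n.+2).
rewrite fps_Dz_psum fcoefD fcoefN mulrAC.
rewrite (@fcoefM_low _ _ ((F - 1) ^+ _)); last first.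
  by move=> k le_kn; rewrite fcoef_exp_low.
rewrite subr0 !fcoef_constM; congr (_ * _).
by apply: eq_fcoefM => k le_kn; rewrite (@fcoef_powr n.+2) // ltnW // ltnS.
Qed.

End BinomialSeries.

(** * Relations between Legendre polynomials, and their generating function *)

Section LegendrePolynomials.
Variable K : fieldType.
Hypothesis charK0 : [pchar K] =i pred0.

Let natK_neq0 n : n.+1%:R != 0 :> K.
Proof. by rewrite ((pcharf0P K).1 charK0). Qed.

Lemma derivnXM (p : {poly K}) n :
  ('X * p)^`(n.+1) = 'X * p^`(n.+1) + n.+1%:R * p^`(n).
Proof.
elim: n => [|n IHn]; first by rewrite !derivn1 derivM derivX derivn0; ring.
rewrite derivnS IHn derivD !derivM derivX -(derivnS p) -(derivnS p).
rewrite -[n.+1%:R]polyC_natr derivC !polyC_natr; ring.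
Qed.

(** Rodrigues' polynomial without its normalising factor, so that its relations have integer
    coefficients. *)
Let rod n : {poly K} := (('X^2 - 1) ^+ n)^`(n).

Let deriv_X2subnM n : (('X^2 - 1 : {poly K}) ^+ n.+1)^`() =
  (2 * n.+1)%:R * ('X * ('X^2 - 1) ^+ n).
Proof.
by rewrite deriv_exp derivB derivXn derivC; ring.
Qed.

Let derivn_natM m (p : {poly K}) n : (m%:R * p)^`(n) = m%:R * p^`(n).
Proof. by rewrite !mulr_natl derivnMn. Qed.

Let deriv_rodS n : (rod n.+1)^`() =
  (2 * n.+1)%:R * ('X * (rod n)^`() + n.+1%:R * rod n).
Proof.
by rewrite /rod -derivnS derivSn deriv_X2subnM derivn_natM derivnXM.
Qed.

(* With u = ('X^2 - 1) ^+ n, eliminates ('X * u)^`(n) between two expressions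
   of rod n.+1: expand ('X * ('X * u) - u)^`(n.+1), or differentiate first. *)
Let rodS n : rod n.+1 = 2 * (('X^2 - 1) * (rod n)^`() + n.+1%:R * ('X * rod n)).
Proof.
set u : {poly K} := ('X^2 - 1) ^+ n.
have rodE : rod n.+1 = (2 * n.+1)%:R * ('X * u)^`(n).
  by rewrite /rod derivSn deriv_X2subnM derivn_natM.
have rodE' : rod n.+1 = 'X * ('X * u)^`(n.+1) + n.+1%:R * ('X * u)^`(n) - u^`(n.+1).
  by rewrite -derivnXM -derivnB /rod exprS; congr (_^`(_)); rewrite -/u; ring.
have -> : rod n.+1 = 2 * rod n.+1 - rod n.+1 by ring.
rewrite {1}rodE' {1}rodE derivnXM /rod -/u -derivnS; ring.
Qed.

Let rodE n : rod n = (2 ^+ n * n`!%:R) * legendre K n.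
Proof.
have c_neq0 : 2 ^+ n * n`!%:R != 0 :> K.
  by rewrite mulf_neq0 ?expf_neq0 ?natK_neq0 // -(prednK (fact_gt0 n)) natK_neq0.
rewrite /legendre -/(rod n) -!natrX -!natrM in c_neq0 *.
by rewrite mulr_natl -scaler_nat scalerA mulfV // scale1r.
Qed.

Let natP_inj n (p q : {poly K}) : n.+1%:R * p = n.+1%:R * q -> p = q.
Proof. by apply: mulfI; rewrite -polyC_natr polyC_eq0. Qed.

(** Puts the normalising factor in the successor form that [natP_inj] cancels. *)
Let rod_factorE n : {k | 2 ^+ n * n`!%:R = k.+1%:R :> {poly K}}.
Proof.
exists (2 ^ n * n`!).-1.
by rewrite prednK ?muln_gt0 ?expn_gt0 ?fact_gt0 // natrM natrX.
Qed.

Lemma legendre0 : legendre K 0 = 1.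
Proof. by rewrite /legendre expr0 fact0 mulr1 invr1 scale1r derivn0 expr0. Qed.

(** This is [rodS] after cancelling [2 ^+ n * n!] and a further factor 2. *)
Lemma legendreS n : n.+1%:R * legendre K n.+1 =
  ('X^2 - 1) * (legendre K n)^`() + n.+1%:R * ('X * legendre K n).
Proof.
have := rodS n; rewrite !rodE exprS factS natrM.
have [k Ek] := rod_factorE n.
rewrite -[2 * _ * _]mulrA [_ ^+ _ * (_ * _)]mulrCA Ek => H.
apply: (@natP_inj k); apply: (@natP_inj 1).
move: H; rewrite -(derivn1 (_ * _)) derivn_natM derivn1 => H.
transitivity (2 * (n.+1%:R * k.+1%:R) * legendre K n.+1); first by ring.
rewrite H; ring.
Qed.

Lemma deriv_legendreS n : (legendre K n.+1)^`() =
  'X * (legendre K n)^`() + n.+1%:R * legendre K n.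
Proof.
have := deriv_rodS n; rewrite !rodE exprS factS natrM.
have [k Ek] := rod_factorE n.
rewrite -[2 * _ * _]mulrA [_ ^+ _ * (_ * _)]mulrCA Ek.
rewrite -!natrM -!derivn1 !derivn_natM !derivn1 => H.
apply: (@natP_inj k); apply: (@natP_inj n); apply: (@natP_inj 1).
transitivity ((2 * (n.+1 * k.+1))%:R * (legendre K n.+1)^`()); first by ring.
rewrite H; ring.
Qed.

Lemma legendre_bonnet n : n.+2%:R * legendre K n.+2 =
  (2 * n.+1).+1%:R * ('X * legendre K n.+1) - n.+1%:R * legendre K n.
Proof.
rewrite legendreS deriv_legendreS.
(* The split [2n+3 = (n+2) + (n+1)] exposes [n.+1%:R * legendre K n.+1]; expanding it by [legendreS]
   makes the derivatives of [legendre K n] cancel. *)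
have -> : (2 * n.+1).+1%:R * ('X * legendre K n.+1) =
  n.+2%:R * ('X * legendre K n.+1) + 'X * (n.+1%:R * legendre K n.+1) by ring.
rewrite legendreS; ring.
Qed.

(** Differentiate [legendreS] and substitute [deriv_legendreS] on the left: the terms [(n+1) x P_n']
    cancel, and [(n+1)^2 - (n+1) = n(n+1)] remains. *)
Lemma legendre_ode n :
  (1 - 'X^2) * (legendre K n)^`()^`() - 2 * 'X * (legendre K n)^`() =
  - (n * n.+1)%:R *: legendre K n.
Proof.
rewrite scaleNr scaler_nat -mulr_natl.
have := congr1 deriv (legendreS n).
rewrite derivD -!derivn1 !derivn_natM !derivn1 deriv_legendreS !derivM derivB.
rewrite derivXn derivX derivC /= expr1 => H.
apply/eqP; rewrite -subr_eq0; apply/eqP.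
move/eqP: H; rewrite -subr_eq0 => /eqP <-; ring.
Qed.

Lemma legendre_genE : legendre_gen K = Fps (legendre K).
Proof.
set F : fps {poly K} := 1 - 2 * fps_x K * fps_z + fps_z ^+ 2.
(* In this form products with [F] are read off by shifting coefficients; [H := 1] gives the
   coefficients of [F] itself. *)
have FE H : F * H = H - 2%:R * (fps_const 'X * (fps_z * H)) + fps_z * (fps_z * H).
  by rewrite /F /fps_x; ring.
have F0 : fcoef F 0 = 1.
  rewrite -[F]mulr1 FE !fcoefD fcoefN fcoef_natM fcoef_constM !fcoef_zM0 fcoef1 /=; ring.
have DF : fps_const (- 2^-1)%:A * fps_Dz F = fps_const 'X - fps_z.
  have two_neq0 := natK_neq0 1.
  have h2 : (- 2^-1)%:A * 2%:R = -1 :> {poly K}.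
    by rewrite mulr_natr -scaler_nat scalerA mulrN mulfV // scaleN1r.
  apply/fpsP => n; rewrite -[F]mulr1 FE fcoef_constM fcoef_Dz !fcoefD !fcoefN.
  rewrite fcoef_natM fcoef_constM !fcoef_zMS.
  case: n => [|[|n]].
  - rewrite fcoef_zM0 !fcoef1 /=.
    transitivity (- ((- 2^-1)%:A * 2%:R) * 'X : {poly K}); first by ring.
    by rewrite h2; ring.
  - rewrite fcoef_zMS !fcoef1 /=.
    transitivity ((- 2^-1)%:A * 2%:R : {poly K}); first by ring.
    by rewrite h2; ring.
  - by rewrite fcoef_zMS !fcoef1 /=; ring.
set G := legendre_gen K.
have odeG : F * fps_Dz G = fps_const 'X * G - fps_z * G.
  by rewrite /G /legendre_gen fps_Dz_powr // mulrA DF mulrBl.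
have G0 : fcoef G 0 = 1.
  by rewrite /= big_ord1 gbinom0 expr0 scale1r.
have G1 : fcoef G 1 = 'X.
  move/fpsP/(_ 0%N): odeG; rewrite FE !fcoefD !fcoefN fcoef_natM !fcoef_constM.
  by rewrite !fcoef_zM0 fcoef_Dz G0 !mulr0 !subr0 addr0 mul1r mulr1.
have GS n : n.+2%:R * fcoef G n.+2 =
    (2 * n.+1).+1%:R * ('X * fcoef G n.+1) - n.+1%:R * fcoef G n.
  move/fpsP/(_ n.+1): odeG; rewrite FE !fcoefD !fcoefN fcoef_natM !fcoef_constM.
  rewrite !fcoef_zMS !fcoef_Dz => H.
  (* The factor [n%:R] also covers [n = 0], where the shifted series has no coefficient to read. *)
  have zDG : fcoef (fps_z * fps_Dz G) n = n%:R * fcoef G n.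
    by case: n {H} => [|n]; rewrite ?fcoef_zM0 ?mul0r // fcoef_zMS fcoef_Dz.
  rewrite zDG in H.
  apply/eqP; rewrite -subr_eq0; apply/eqP.
  move/eqP: H; rewrite -subr_eq0 => /eqP <-; ring.
apply/fpsP => n; change (fcoef G n = legendre K n).
(* The recurrence has order two, so the induction carries two consecutive coefficients. *)
suff [] : fcoef G n = legendre K n /\ fcoef G n.+1 = legendre K n.+1 by [].
elim: n => [|n [IHn IHn1]]; last first.
  split=> //; apply: (@natP_inj n.+1).
  by rewrite GS legendre_bonnet IHn IHn1.
rewrite G0 G1 legendre0; split=> //; apply: (@natP_inj 0).
by rewrite legendreS legendre0 derivC mulr0 add0r mulr1.
Qed.

Lemma fcoef_legendre_op (F : fps {poly K}) n : fcoef (legendre_op F) n =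
  (1 - 'X^2) * (fcoef F n)^`()^`() - 2 * 'X * (fcoef F n)^`().
Proof.
rewrite /legendre_op /fps_x mulrBl mul1r expr2 -!mulrA !fcoefD !fcoefN.
rewrite fcoef_natM !fcoef_constM /=; ring.
Qed.

Lemma iter_legendre_op r :
  iter r (@legendre_op K) (legendre_gen K) =
  (-1) ^+ r * iter r (@euler_op K) (legendre_gen K).
Proof.
have coefE i n : fcoef (iter i (@euler_op K) (legendre_gen K)) n =
    (n * n.+1)%:R ^+ i *: legendre K n.
  elim: i => [|i IHi]; first by rewrite legendre_genE scale1r.
  by rewrite iterS fcoef_euler_op IHi mulr_natl -scaler_nat scalerA exprS.
have coefL i n : fcoef (iter i (@legendre_op K) (legendre_gen K)) n =
    (- (n * n.+1)%:R) ^+ i *: legendre K n.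
  elim: i => [|i IHi]; first by rewrite legendre_genE scale1r.
  (* [exprSr] leaves one eigenvalue next to [legendre K n], where [legendre_ode] turns it back into
     the operator. *)
  rewrite iterS fcoef_legendre_op IHi [in RHS]exprSr -scalerA -legendre_ode.
  by rewrite scalerBr !(derivZ, scalerAr).
apply/fpsP => n; rewrite coefL exprNn -scalerA -coefE.
(* The sign is a scalar of [K] on the left and a power series on the right; reducing to parity
   reconciles them. *)
rewrite -signr_odd -[in RHS]signr_odd.
by case: odd; rewrite ?expr1 ?scaleN1r ?mulN1r ?scale1r ?mul1r.
Qed.

End LegendrePolynomials.

(** The first two clauses certify the expansion of [G] and the factored form of the Euler operator;
    the third is the operator identity. *)
Theorem corollary4p12 (R : realType) :
  [/\ legendre_gen R[i] = Fps (legendre R[i]),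
      (forall F : fps {poly R[i]},
         euler_op F = fps_z * fps_Dz (fps_z * fps_Dz F + F))
    & forall r : nat, (1 <= r)%N ->
        iter r (@legendre_op R[i]) (legendre_gen R[i]) =
          (-1) ^+ r * iter r (@euler_op R[i]) (legendre_gen R[i])].
Proof.
have charC0 := @Num.Theory.pchar_num R[i].
split=> [|F|r _]; first exact: legendre_genE.
- exact: euler_opE.
- exact: iter_legendre_op.
Qed.
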